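(* Fix $N\geq1$ and let $K=\mathbb{C}[a_{ij}:0\leq i\leq j\leq N,\ j>0]$. Let $I^N\in K[[q]][h]/(h^{N+1})$ be the abstract $I$-series, $\widetilde{I}^N$ the abstract regularized $I$-series, $L^Q_N\in K[q][D]$ the abstract quantum differential operator and $L_N$ the abstract operator, all as defined in the context. Then: (1) $I^N$ is a perturbed solution of $L^Q_N$; (2) $\widetilde I^N\bmod h^N$ is a perturbed solution of $L_N$.
   Context: Minimal Gromov–Witten ring $GW$. Symbols. Consider formal symbols $\langle\tau_{d_1}H^{i_1},\ldots,\tau_{d_{n-1}}H^{i_{n-1}},\tau_{d_n}H_r\rangle$ with $n\geq1$ and all indices in $\mathbb{Z}_{\geq0}$; $H^i$ means $\tau_0H^i$ and $H_j$ means $\tau_0H_j$. The degree of a symbol is $\sum d_s+\sum_{s<n}i_s-r+3-n$, and $F$ is the set of symbols of non-negative degree. Set $GW=\mathbb{C}[F]/\mathrm{Rel}$. Expressions on a right-hand side with a negative index or negative degree count as $0$. The ideal $\mathrm{Rel}$ is generated by the following relations. (GW1) Symbols are invariant under permuting their first $n-1$ entries. (GW2) A symbol of degree $0$ equals $\frac{(\sum d_s)!}{\prod d_s!}$ if $\sum d_s=n-3$, and equals $0$ otherwise. (GW3) $\langle H^0,\tau_{d_1}H^{i_1},\ldots,\tau_{d_n}H_r\rangle=\sum_{j=1}^n(\text{the symbol }\langle\tau_{d_1}H^{i_1},\ldots,\tau_{d_n}H_r\rangle\text{ with }d_j\text{ replaced by }d_j-1)$. The symbols $\langle H^0,H^i,H_i\rangle$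 are excluded; they are given by (GW2). (GW4) If the left-hand side has degree $d>0$, then $\langle H^1,\tau_{d_1}H^{i_1},\ldots,\tau_{d_n}H_r\rangle=d\langle\tau_{d_1}H^{i_1},\ldots,\tau_{d_n}H_r\rangle+\sum_{s<n}\langle\ldots,\tau_{d_s-1}H^{i_s+1},\ldots,\tau_{d_n}H_r\rangle+\langle\tau_{d_1}H^{i_1},\ldots,\tau_{d_n-1}H_{r-1}\rangle$. (GW5) Topological recursion. For $n\geq0$ and a family $\coprod_S$ of entries $\tau_{c_s}H^{i_s}$, $s\in S\subset\{1,\ldots,n\}$: - if $d_1\geq1$: $\langle\coprod_{\{1..n\}},\tau_{d_1}H^{j_1},\tau_{d_2}H^{j_2},\tau_{d_3}H_r\rangle=\sum\langle\tau_{d_1-1}H^{j_1},\coprod_{S_1},H_a\rangle\langle H^a,\coprod_{S_2},\tau_{d_2}H^{j_2},\tau_{d_3}H_r\rangle$; - if $d_3\geq1$: the same left-hand side equals $\sum\langle\coprod_{S_1},\tau_{d_1}H^{j_1},\tau_{d_2}H^{j_2},H_a\rangle\langle H^a,\coprod_{S_2},\tau_{d_3-1}H_r\rangle$. Both sums run over all splittings $S_1\sqcup S_2=\{1,\ldots,n\}$ and all $a\geq0$ for which every symbol has non-negative degree. Identification with polynomials. Let $A=\mathbb{C}[a_{ij}:0\leq i\leq j,\ j>0]$. The map $r\colon A\to GW$, $a_{ij}\mapsto\langle H^1,H^j,H_i\rangle$, is an isomorphism. For a symbol $C$ write $[C]=r^{-1}(C)\in A$. Let $r_N\colon A\to K$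 send $a_{ij}\mapsto a_{ij}$ if $i,j\leq N$ and $a_{ij}\mapsto0$ otherwise. Abstract $I$-series. The symbol $\langle\tau_iH_j\rangle$ has degree $i-j+2$. Define $I^N=1+\sum_{0\leq j\leq N,\ i\geq0,\ i-j+2>0}r_N([\langle\tau_iH_j\rangle])\,q^{i-j+2}h^j$ and $\widetilde I^N=1+\sum_{0\leq j\leq N,\ i\geq0,\ i-j+2>0}r_N([\langle\tau_iH_j\rangle])\,q^{i-j+2}h^j(h+1)(h+2)\cdots(h+i-j+2)$, both modulo $h^{N+1}$. Operators. Let $D=q\frac{d}{dq}$ and set $a_{00}:=0$. Let $M^N$ be the $(N+1)\times(N+1)$ matrix over $K[q][D]$ with: - $M^N_{ii}=D-a_{ii}q$; - $M^N_{ij}=-a_{ij}q^{j-i+1}$ for $i<j$; - $M^N_{i+1,i}=-1$; - all other entries $0$. Right determinant: for a $1\times1$ matrix $X$, $\det_{\mathrm{right}}X=X_{00}$; for an $(m+1)\times(m+1)$ matrix, $\det_{\mathrm{right}}X=\sum_{i=0}^mX_{im}(-1)^{i+m}\det_{\mathrm{right}}X^{(i,m)}$, with $X^{(i,m)}$ obtained by deleting row $i$ and column $m$, and products taken in this order. Put $L^Q_N=\det_{\mathrm{right}}(M^N)$ and write $L^Q_N=\sum_kq^kP_k(D)$ with $P_k\in K[D]$. Then $L_N$ is defined by $DL_N=\sum_kq^kP_k(D)(D+1)\cdots(D+k)$. Perturbed solutions. Operators in $K[q][D]$ act $K$-linearly on $K[[q]][t]$, with $D(f(q)t^m)=qf'(q)t^m+mf(q)t^{m-1}$.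 Given $I=\sum_{k=0}^{M}I^k(q)h^k$ with $I^k\in K[[q]]$, set $I_r=\sum_{m=0}^rI^{r-m}(q)t^m/m!$. Then $I$ is a perturbed solution of $P$ if $PI_r=0$ for all $0\leq r\leq M$. Here $M=N$ for $I^N$ and $M=N-1$ for $\widetilde I^N\bmod h^N$. *)

(* Defs.v *)
From HB Require Import structures.
From mathcomp Require Import all_boot all_algebra.
From mathcomp Require Import Rstruct complex mpoly.
Set Implicit Arguments.
Unset Strict Implicit.
Unset Printing Implicit Defensive.
Import GRing.Theory.
Local Open Scope ring_scope.

Definition CC : fieldType := (Rdefinitions.R)[i].

(* The coefficient ring K = C[a_ij : 0 <= i <= j <= N, j > 0].              *)
(* The variables are enumerated by j then i:  (i,j) |-> j(j+1)/2 + i - 1,   *)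
(* a bijection onto {0, ..., nvars N - 1}.                                   *)
Definition nvars (N : nat) : nat := ((N.+1 * N.+2)./2 - 1)%N.
Definition aidx (i j : nat) : nat := ((j * j.+1)./2 + i - 1)%N.
Definition K (N : nat) := {mpoly CC[nvars N]}.

(* r_N(a_ij) : equals the variable a_ij when i <= j <= N, j > 0; and 0 for
   j > N (also 0 for the convention a_00 := 0 and out-of-range pairs). *)
Definition aK (N : nat) (i j : nat) : K N :=
  if [&& (i <= j)%N, (0 < j)%N & (j <= N)%N]
  then oapp (fun k : 'I_(nvars N) => 'X_k) 0 (insub (aidx i j))
  else 0.

(* Gromov-Witten symbols  < tau_{d_1}H^{i_1}, ..., tau_{d_{n-1}}H^{i_{n-1}},
   tau_{d_n}H_r >  are encoded as  (l, d_n, r)  with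
   l = [:: (d_1,i_1); ...; (d_{n-1},i_{n-1})]  (so n = size l + 1).          *)
Section Symbols.
Variables (F : fieldType) (R : lalgType F).

Definition sdeg (l : seq (nat * nat)) (dn r : nat) : int :=
  ((sumn (map fst l) + dn + sumn (map snd l))%:Z - r%:Z + 3 - (size l).+1%:Z)%R.

Definition inF (l : seq (nat * nat)) (dn r : nat) : bool := (0 <= sdeg l dn r)%R.

Variable v : seq (nat * nat) -> nat -> nat -> R.

Definition sv (l : seq (nat * nat)) (dn r : nat) : R :=
  if inF l dn r then v l dn r else 0.

Definition GW1 : Prop :=
  forall l l' dn r, inF l dn r -> perm_eq l l' -> v l dn r = v l' dn r.

Definition GW2 : Prop :=
  forall l dn r, sdeg l dn r = 0 ->
    v l dn r =
      if ((sumn (map fst l) + dn)%N%:Z == ((size l).+1%:Z - 3)%R)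
      then (((sumn (map fst l) + dn)`!)%:R
             / ((\prod_(x <- l) (x.1)`!) * dn`!)%:R : F) *: 1
      else 0.

Definition GW3 : Prop :=
  forall l dn r, inF ((0, 0)%N :: l) dn r ->
    ~ (exists i, [/\ l = [:: (0, i)%N], dn = 0%N & r = i]) ->
    v ((0, 0)%N :: l) dn r =
      \sum_(s < size l)
         (if (0 < (nth (0, 0)%N l s).1)%N
          then sv (set_nth (0, 0)%N l s
                     ((nth (0, 0)%N l s).1.-1, (nth (0, 0)%N l s).2)) dn r
          else 0)
      + (if (0 < dn)%N then sv l dn.-1 r else 0).

Definition GW4 : Prop :=
  forall l dn r, (0 < sdeg ((0, 1)%N :: l) dn r)%R ->
    v ((0, 1)%N :: l) dn r =
      (sdeg ((0, 1)%N :: l) dn r)%:~R * sv l dn r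
      + \sum_(s < size l)
         (if (0 < (nth (0, 0)%N l s).1)%N
          then sv (set_nth (0, 0)%N l s
                     ((nth (0, 0)%N l s).1.-1, (nth (0, 0)%N l s).2.+1)) dn r
          else 0)
      + (if (0 < dn)%N && (0 < r)%N then sv l dn.-1 r.-1 else 0).

(* (GW5) topological recursion.  The family (tau_{c_s}H^{i_s})_{s=1..n} is
   the list l; splittings S_1 |_| S_2 are encoded by boolean masks m; the sums
   over a are finite (bounds below exceed every a giving non-negative degree)
   and terms of negative degree count as 0 via sv. *)
Definition GW5 : Prop :=
  forall (l : seq (nat * nat)) (d1 j1 d2 j2 d3 r : nat),
    inF (l ++ [:: (d1, j1); (d2, j2)]) d3 r ->
    ((0 < d1)%N ->
      v (l ++ [:: (d1, j1); (d2, j2)]) d3 r =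
        \sum_(m : (size l).-tuple bool)
         \sum_(a < d1 + j1 + sumn (map fst l) + sumn (map snd l) + 2)
            sv ((d1.-1, j1) :: mask m l) 0 a
            * sv ((0%N, val a) :: (mask (map negb m) l ++ [:: (d2, j2)])) d3 r)
    /\
    ((0 < d3)%N ->
      v (l ++ [:: (d1, j1); (d2, j2)]) d3 r =
        \sum_(m : (size l).-tuple bool)
         \sum_(a < d1 + d2 + j1 + j2 + sumn (map fst l) + sumn (map snd l) + 2)
            sv (mask m l ++ [:: (d1, j1); (d2, j2)]) 0 a
            * sv ((0%N, val a) :: mask (map negb m) l) d3.-1 r).

(* v : F -> R respects all relations (GW1)-(GW5) and sends the generators
   <H^1,H^j,H_i> (0 <= i <= j, j > 0) to the prescribed elements a i j.
   Such v are exactly the ring maps GW -> R extending a. *)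
Definition GW_valuation (a : nat -> nat -> R) : Prop :=
  [/\ GW1, GW2, GW3, GW4 & GW5] /\
      (forall i j, (i <= j)%N -> (0 < j)%N ->
        v [:: (0, 1)%N; (0, j)] 0 i = a i j).

End Symbols.

(* The (non-commutative) ring R[q][D], elements written in normal form
   sum_k q^k P_k(D), represented as {poly {poly R}}: the outer variable is q,
   the coefficient of q^k is P_k(D).  Product: q^a P(D) . q^b Q(D)
   = q^(a+b) P(D+b) Q(D), since D q = q (D+1). *)
Section Operators.
Variable R : comNzRingType.

Definition opmul (A B : {poly {poly R}}) : {poly {poly R}} :=
  \sum_(a < size A) \sum_(b < size B)
     ((A`_a \Po ('X + b%:R)) * B`_b)%:P * 'X^(a + b).

Definition Dop : {poly {poly R}} := ('X)%:P.

Fixpoint detR (m : nat) (X : nat -> nat -> {poly {poly R}}) : {poly {poly R}} :=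
  match m with
  | 0 => X 0%N 0%N
  | m'.+1 =>
      \sum_(i < m'.+2)
        (-1) ^+ (i + m'.+1) *
        opmul (X i m'.+1)
              (detR m' (fun k l => X (if (k < i)%N then k else k.+1) l))
  end.

Definition MQ (a : nat -> nat -> R) (i j : nat) : {poly {poly R}} :=
  if i == j then Dop - (a i i)%:P%:P * 'X
  else if (i < j)%N then - ((a i j)%:P%:P * 'X^(j - i + 1))
  else if i == j.+1 then -1
  else 0.

Definition LQ (N : nat) (a : nat -> nat -> R) : {poly {poly R}} :=
  detR N (MQ a).

Definition LN_spec (LQ L : {poly {poly R}}) : Prop :=
  opmul Dop L =
    \sum_(k < size LQ) (LQ`_k * \prod_(l < k) ('X + (l.+1)%:R))%:P * 'X^k.

(* Action on R[[q]][t]; an element is given by its coefficients f n m of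
   q^n t^m.  D (f(q) t^m) = q f'(q) t^m + m f(q) t^(m-1). *)
Definition Dact (f : nat -> nat -> R) : nat -> nat -> R :=
  fun n m => n%:R * f n m + (m.+1)%:R * f n m.+1.

Definition actD (P : {poly R}) (f : nat -> nat -> R) : nat -> nat -> R :=
  fun n m => \sum_(l < size P) P`_l * iter l Dact f n m.

Definition act (A : {poly {poly R}}) (f : nat -> nat -> R) : nat -> nat -> R :=
  fun n m => \sum_(k < size A) (if (k <= n)%N then actD A`_k f (n - k) m else 0).

End Operators.

(* Perturbed solutions.  I = sum_{k<=M} I^k(q) h^k is given by Ic k n =
   coefficient of q^n h^k.  I_r = sum_{m=0}^r I^{r-m}(q) t^m / m!.          *)
Section Perturbed.
Variables (F : fieldType) (R : comAlgType F).

Definition Ir (Ic : nat -> nat -> R) (r : nat) : nat -> nat -> R :=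
  fun n m => if (m <= r)%N then ((m`!)%:R^-1 : F) *: Ic (r - m)%N n else 0.

Definition perturbed_solution (M : nat) (Ic : nat -> nat -> R)
    (P : {poly {poly R}}) : Prop :=
  forall r, (r <= M)%N -> forall n m, act P (Ir Ic r) n m = 0.

End Perturbed.

(* Abstract I-series.  Given the values v <tau_i H_j> = r_N([<tau_i H_j>]),
   the coefficient of q^n in I^N (resp. tilde I^N) is a polynomial in h.
   The term with q^(i-j+2) h^j has n = i - j + 2 > 0, i.e. i = n + j - 2 >= 0. *)
Section ISeries.
Variables (R : comNzRingType) (N : nat) (v : seq (nat * nat) -> nat -> nat -> R).

Definition Ipoly (n : nat) : {poly R} :=
  (n == 0%N)%:R +
  \sum_(j < N.+1)
     (if (0 < n)%N && (2 <= n + j)%N then v [::] (n + j - 2)%N j *: 'X^j else 0).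

Definition Itpoly (n : nat) : {poly R} :=
  (n == 0%N)%:R +
  \sum_(j < N.+1)
     (if (0 < n)%N && (2 <= n + j)%N
      then v [::] (n + j - 2)%N j *: ('X^j * \prod_(l < n) ('X + (l.+1)%:R))
      else 0).

Definition Icoef (k n : nat) : R := if (k <= N)%N then (Ipoly n)`_k else 0.

Definition Itcoef (k n : nat) : R := if (k < N)%N then (Itpoly n)`_k else 0.

End ISeries.

(* Main.v *)
(** Put Phi_j = h^j + sum <H^j, tau_{n+k-j-1} H_k> q^n h^k over n > 0.  Comparing
    the two expansions of <H^1, H^j, tau_d H_k> given by the divisor relation
    (GW4) and by topological recursion (GW5) yields
      (D + h) Phi_j = sum_(i <= j) a_ij q^(j-i+1) Phi_i + Phi_{j+1}.
    The matrix M^N is upper Hessenberg, so expanding its right determinant along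
    the last column gives the same recursion for its leading minors, and these
    send I^N = Phi_0 to Phi_j.  Hence L^Q_N I^N = Phi_{N+1}, which vanishes modulo
    h^(N+1) because a_ij = 0 for j > N.  For (2), the coefficient of q^n in
    D L_N applied to the regularized series is (h+1)...(h+n) times that of
    L^Q_N I^N, and cancelling D, which multiplies it by n + h, costs one power
    of h, when n = 0. *)

Require Import Defs.
From HB Require Import structures.
From mathcomp Require Import all_boot all_order all_algebra.
From mathcomp Require Import Rstruct complex mpoly.
From mathcomp Require Import zify.
Set Implicit Arguments.
Unset Strict Implicit.
Unset Printing Implicit Defensive.
Import Order.TTheory GRing.Theory.
Local Open Scope ring_scope.

(** * Composition of operators in normal form and their action on series in q over R[h] *)

Section OperatorAction.
Variable R : comNzRingType.
Implicit Types (A B : {poly {poly R}}) (P : nat -> {poly R}).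

Lemma coef_opmul A B c :
  (opmul A B)`_c =
    \sum_(a < c.+1) (A`_a \Po ('X + (c - a)%:R)) * B`_(c - a).
Proof.
pose t a b := (A`_a \Po ('X + b%:R)) * B`_b.
have tA a b : (size A <= a)%N -> t a b = 0.
  by move=> h; rewrite /t (nth_default _ h) comp_poly0 mul0r.
have tB a b : (size B <= b)%N -> t a b = 0.
  by move=> h; rewrite /t (nth_default _ h) mulr0.
have inner a : \sum_(b < size B) t a b *+ (c == a + b)%N =
    if (a <= c)%N then t a (c - a)%N else 0.
  case: (leqP a c) => h.
    have [hb|hb] := ltnP (c - a) (size B).
      rewrite (bigD1 (Ordinal hb)) //= subnKC // eqxx big1 ?addr0 // => b.
      rewrite -val_eqE /= => hne; case: eqP => // e.
      by rewrite e addKn eqxx in hne.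
    rewrite tB // big1 // => b _; case: eqP => // e.
    by rewrite e addKn leqNgt ltn_ord in hb.
  by rewrite big1 // => b _; case: eqP => // e; lia.
transitivity (\sum_(a < size A) (if (a < c.+1)%N then t a (c - a)%N else 0)).
  rewrite /opmul coef_sum; apply: eq_bigr => a _; rewrite -inner coef_sum.
  by apply: eq_bigr => b _; rewrite coefCM coefXn mulr_natr.
rewrite -big_mkcond /=.
rewrite (big_ord_widen_cond (maxn (size A) c.+1) (fun a => (a < c.+1)%N)
  (fun a => t a (c - a)%N)) ?leq_maxl //.
rewrite (big_ord_widen (maxn (size A) c.+1) (fun a => t a (c - a)%N)) ?leq_maxr //.
rewrite [RHS](bigID (fun a : 'I__ => (a < size A)%N)) /= [X in _ = _ + X]big1 ?addr0 //.
by move=> a /andP[_]; rewrite -leqNgt; apply: tA.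
Qed.

(* The action of operators on series in q with coefficients in R[h] for which
   D (q^n p(h)) = (n + h) q^n p(h); lemma act_Ir relates it to the action on
   K[[q]][t] through I |-> I_r. *)
Definition hact A P (n : nat) : {poly R} :=
  \sum_(k < n.+1) (A`_k \Po ('X + (n - k)%:R)) * P (n - k)%N.

Lemma eq_hact A P P' n : P =1 P' -> hact A P n = hact A P' n.
Proof. by move=> e; apply: eq_bigr => k _; rewrite e. Qed.

Lemma hact0 P n : hact 0 P n = 0.
Proof. by apply: big1 => k _; rewrite coef0 comp_poly0 mul0r. Qed.

Lemma hactD A B P n : hact (A + B) P n = hact A P n + hact B P n.
Proof.
by rewrite /hact -big_split; apply: eq_bigr => k _; rewrite coefD raddfD mulrDl.
Qed.

Lemma hactN A P n : hact (- A) P n = - hact A P n.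
Proof.
by rewrite /hact -sumrN; apply: eq_bigr => k _; rewrite coefN raddfN mulNr.
Qed.

Lemma hact_sum m (A : 'I_m -> {poly {poly R}}) P n :
  hact (\sum_i A i) P n = \sum_i hact (A i) P n.
Proof.
exact: (big_morph (fun A => hact A P n) (fun A B => hactD A B P n) (hact0 P n)).
Qed.

Lemma hact_monom (c : {poly R}) k P n :
  hact (c%:P * 'X^k) P n =
    if (k <= n)%N then (c \Po ('X + (n - k)%:R)) * P (n - k)%N else 0.
Proof.
rewrite /hact; case: leqP => h.
  rewrite (bigD1 (Ordinal (h : (k < n.+1)%N))) //= coefCM coefXn eqxx mulr1.
  rewrite big1 ?addr0 // => i; rewrite -val_eqE /= => /negPf hi.
  by rewrite coefCM coefXn hi mulr0 comp_poly0 mul0r.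
apply: big1 => i _; rewrite coefCM coefXn (_ : (i == k :> nat) = false).
  by rewrite mulr0 comp_poly0 mul0r.
by apply/negbTE; have := ltn_ord i; lia.
Qed.

Lemma hactC (c : {poly R}) P n : hact c%:P P n = (c \Po ('X + n%:R)) * P n.
Proof. by have := hact_monom c 0 P n; rewrite expr0 mulr1 subn0. Qed.

Lemma hact1 P n : hact 1 P n = P n.
Proof. by rewrite -[1]/(1%:P) hactC -[1]/(1%:P) comp_polyC mul1r. Qed.

(** Composition of operators becomes composition of actions: commuting D past q shifts it by 1, and
    the shifts c - a and n - c add up to n - a. *)
Lemma hact_opmul A B P n : hact (opmul A B) P n = hact A (hact B P) n.
Proof.
rewrite /hact.
pose f (a b : nat) := (A`_a \Po ('X + (n - a)%:R)) *
  ((B`_b \Po ('X + (n - a - b)%:R)) * P (n - a - b)%N).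
transitivity (\sum_(c < n.+1) \sum_(a < n.+1 | (a <= c)%N) f a (c - a)%N).
  apply: eq_bigr => c _; rewrite coef_opmul raddf_sum mulr_suml /=.
  rewrite (big_ord_widen n.+1 (fun a : nat =>
    ((A`_a \Po ('X + (c - a)%:R)) * B`_(c - a) \Po ('X + (n - c)%:R))
      * P (n - c)%N)) //.
  apply: eq_big => [a|a]; rewrite ltnS // => hac.
  have hcn : (c <= n)%N by rewrite -ltnS.
  rewrite /f (_ : (n - a - (c - a)) = n - c)%N; last by lia.
  rewrite rmorphM /= -mulrA; congr (_ * _).
  rewrite -comp_polyA; congr (_ \Po _).
  rewrite rmorphD /= comp_polyX rmorph_nat -addrA -natrD.
  by congr (_ + _%:R); lia.
(* Swap the sums and set c = a + b. *)
rewrite (exchange_big_dep predT) //=; apply: eq_bigr => a _.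
rewrite mulr_sumr.
have ha : (a <= n)%N by rewrite -ltnS.
rewrite -(big_mkord (fun c => (a <= c)%N) (fun c => f a (c - a)%N)).
rewrite (big_cat_nat (n := a)) //=; last by apply: leqW.
rewrite big_nat_cond big1 ?add0r; last first.
  by move=> i /andP[/andP[_ h1] h2]; lia.
rewrite -{1}[val a]add0n big_addn subSn // big_mkord.
apply: eq_big => [b|b _]; first by rewrite leq_addl.
by rewrite addnK.
Qed.

Lemma hact_opmulr A B m P n :
  hact (opmul A ((-1) ^+ m * B)) P n = (-1) ^+ m * hact (opmul A B) P n.
Proof.
rewrite hact_opmul -signr_odd -[in RHS]signr_odd; case: (odd m).
  rewrite expr1 !mulN1r hact_opmul /hact -sumrN; apply: eq_bigr => k _.
  by rewrite -/(hact _ _ _) hactN mulrN.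
by rewrite expr0 !mul1r hact_opmul.
Qed.

Lemma hact_sign m A P n : hact ((-1) ^+ m * A) P n = (-1) ^+ m * hact A P n.
Proof.
by rewrite -signr_odd -[in RHS]signr_odd; case: (odd m);
  rewrite ?expr1 ?mulN1r ?hactN ?expr0 ?mul1r.
Qed.

(** * Right determinants of upper Hessenberg matrices *)

Lemma opmul_0r A : opmul A 0 = 0.
Proof. by apply: big1 => a _; rewrite size_poly0 big_ord0. Qed.

Lemma opmulN1 A : opmul (-1) A = - A.
Proof.
apply/polyP => c; rewrite coef_opmul big_ord_recl big1 => [|i _].
  rewrite subn0 addr0 coefN coef1 eqxx coefN -[1]/(1%:P : {poly R}).
  by rewrite -polyCN comp_polyC polyCN mulN1r.
by rewrite coefN coef1 /= oppr0 comp_poly0 mul0r.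
Qed.

Lemma opmul_0l A : opmul 0 A = 0.
Proof. by rewrite /opmul size_poly0 big_ord0. Qed.

Lemma eq_detR m (X Y : nat -> nat -> {poly {poly R}}) :
  (forall i j, (i <= m)%N -> (j <= m)%N -> X i j = Y i j) ->
  detR m X = detR m Y.
Proof.
elim: m X Y => [|m IH] X Y e /=; first exact: e.
apply: eq_bigr => i _; congr (_ * opmul _ _); first by apply: e; rewrite // leq_ord.
by apply: IH => k l hk hl; apply: e; [case: ifP => _; lia | lia].
Qed.

(** In each term of the expansion the zero row either survives as last row of the minor, or is the
    deleted one and supplies a zero left factor. *)
Lemma detR_row0 m (X : nat -> nat -> {poly {poly R}}) :
  (forall j, (j <= m)%N -> X m j = 0) -> detR m X = 0.
Proof.
elim: m X => [|m IH] X e /=; first exact: e.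
apply: big1 => i _; have [hi|hi] := ltnP i m.+1.
  rewrite IH ?opmul_0r ?mulr0 // => j hj.
  by rewrite ltnNge -ltnS hi /=; apply/e/leqW.
have -> : i = m.+1 :> nat by have := ltn_ord i; lia.
by rewrite e // opmul_0l mulr0.
Qed.

(** Leading j x j minor; the empty minor is 1, which starts the recursion. *)
Definition detlead (X : nat -> nat -> {poly {poly R}}) (j : nat) :=
  if j is j'.+1 then detR j' X else 1.

Section Hessenberg.
Variable X : nat -> nat -> {poly {poly R}}.
Hypothesis Xsub : forall j, X j.+1 j = -1.
Hypothesis Xlow : forall i j, (j.+1 < i)%N -> X i j = 0.

(* In the expansion of the minor along its last column all the terms but the
   last have a zero row. *)
Lemma detR_Hessenberg_minor m i : (i <= m.+1)%N ->
  detR m (fun k l => X (if (k < i)%N then k else k.+1) l) =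
    (-1) ^+ (m.+1 - i) * detlead X i.
Proof.
elim: m => [|m IH] hi.
  by case: i hi => [|[|//]] _ /=; rewrite ?Xsub ?mulr1 ?expr0 ?mul1r.
rewrite leq_eqVlt in hi; case/orP: hi => [/eqP ->|hi].
  rewrite subnn expr0 mul1r; apply: eq_detR => k l hk _.
  by rewrite ltnS hk.
rewrite [LHS]/= big_ord_recr /= big1 => [|k _].
  rewrite ltnNge -ltnS hi /= Xsub opmulN1 add0r -signr_odd addnn odd_double.
  rewrite expr0 mul1r subSn // exprS -mulrA mulN1r; congr (- _).
  rewrite -IH //; apply: eq_detR => k l hk _.
  by rewrite ltnS hk.
rewrite detR_row0 ?opmul_0r ?mulr0 // => j hj.
rewrite [(m < k)%N]ltnNge leq_ord /= ltnNge -ltnS hi.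
by apply: Xlow; rewrite !ltnS.
Qed.

(** The sign (-1)^(i+j) of the expansion cancels the (-1)^(j-i) coming from the subdiagonal entries
    -1. Entries stand left of minors, so they act last. *)
Lemma hact_detlead_Hessenberg j P n :
  hact (detlead X j.+1) P n =
    \sum_(i < j.+1) hact (X i j) (hact (detlead X i) P) n.
Proof.
case: j => [|j] /=.
  by rewrite big_ord1 /=; apply: eq_bigr => k _; rewrite hact1.
rewrite hact_sum; apply: eq_bigr => i _.
rewrite detR_Hessenberg_minor; last by rewrite -ltnS.
rewrite hact_sign hact_opmulr mulrA -exprD hact_opmul.
rewrite (_ : (i + j.+1 + (j.+1 - i)) = j.+1.*2)%N; last by have := ltn_ord i; lia.
by rewrite -signr_odd odd_double expr0 mul1r.
Qed.
End Hessenberg.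

(** * Size-free form of the action, and regularization *)

Lemma actE A (f : nat -> nat -> R) n m :
  act A f n m = \sum_(k < n.+1) actD A`_k f (n - k) m.
Proof.
rewrite /act -big_mkcond /=.
pose G k := actD A`_k f (n - k) m.
rewrite (big_ord_widen_cond (maxn (size A) n.+1) (fun k => (k <= n)%N) G) ?leq_maxl //.
rewrite (big_ord_widen (maxn (size A) n.+1) G) ?leq_maxr //.
rewrite [RHS](bigID (fun k : 'I__ => (k < size A)%N)) /= [X in _ = _ + X]big1 ?addr0 //.
move=> k /andP[_]; rewrite -leqNgt => hk.
by rewrite /G /actD (nth_default _ hk) size_poly0 big_ord0.
Qed.

(** On q^(n-k) the factor (D+1)...(D+k) becomes (h+n-k+1)...(h+n), which completes (h+1)...(h+n-k)
    to (h+1)...(h+n). *)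
Lemma regularized_hact A P n :
  hact (\sum_(k < size A) (A`_k * \prod_(l < k) ('X + (l.+1)%:R))%:P * 'X^k)
    (fun m => \prod_(l < m) ('X + (l.+1)%:R) * P m) n =
  \prod_(l < n) ('X + (l.+1)%:R) * hact A P n.
Proof.
rewrite /hact mulr_sumr; apply: eq_bigr => k _.
have hk : (k <= n)%N by rewrite -ltnS.
have prodE : (\prod_(l < k) ('X + (l.+1)%:R) \Po ('X + (n - k)%:R)) *
    \prod_(l < n - k) ('X + (l.+1)%:R) = \prod_(l < n) ('X + (l.+1)%:R) :> {poly R}.
  rewrite -!(big_mkord predT (fun l => 'X + (l.+1)%:R)) rmorph_prod /= mulrC.
  rewrite [RHS](big_cat_nat (n := (n - k)%N)) ?leq_subr //=; congr (_ * _).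
  rewrite -{2}[(n - k)%N]add0n big_addn subKn //; apply: eq_bigr => l _.
  by rewrite rmorphD /= comp_polyX rmorph_nat -addrA -natrD addnS addnC.
have -> : (\sum_(i < size A)
    (A`_i * \prod_(l < i) ('X + (l.+1)%:R))%:P * 'X^i)`_k =
    A`_k * \prod_(l < k) ('X + (l.+1)%:R).
  under eq_bigr => i _ do rewrite mul_polyC.
  rewrite -(poly_def _ (fun i => A`_i * \prod_(l < i) ('X + (l.+1)%:R))) coef_poly.
  by case: ltnP => // h; rewrite (nth_default _ h) mul0r.
rewrite comp_polyM -prodE [X in X * _]mulrC; exact: mulrACA.
Qed.

End OperatorAction.

(** * From the action on K[[q]][t] to the action on series in h *)

Section PerturbedAction.
Variables (F : fieldType) (R : comAlgType F).
Hypothesis charF : [pchar F] =i pred0.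

Lemma eq_act (A : {poly {poly R}}) f g n m :
  (forall n' m', f n' m' = g n' m') -> act A f n m = act A g n m.
Proof.
move=> e; have eD l n' m' : iter l (@Dact R) f n' m' = iter l (@Dact R) g n' m'.
  by elim: l n' m' => [|l IH] n' m' //=; rewrite /Dact !IH.
apply: eq_bigr => k _; case: ifP => // _; apply: eq_bigr => l _.
by rewrite eD.
Qed.

Definition hcoef (P : nat -> {poly R}) (k n : nat) : R := (P n)`_k.

(** Differentiation in t corresponds to multiplication by h, because (m+1)/(m+1)! = 1/m! in
    characteristic 0. *)
Lemma Dact_Ir P r n m :
  Dact (Ir (hcoef P) r) n m = Ir (hcoef (fun i => ('X + i%:R) * P i)) r n m.
Proof.
have ch0 := (pcharf0P F).1 charF.
rewrite /Dact /Ir /hcoef mulrDl coefD coefXM !mulr_natl coefMn.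
have [hm|hm] := leqP m r; last by rewrite ifF ?mul0rn ?addr0 //; lia.
rewrite scalerDr addrC scalerMnr; congr (_ + _).
have [hr|hr] := ltnP m r; last first.
  by rewrite (_ : r - m = 0)%N ?eqxx ?scaler0 ?mul0rn //; lia.
rewrite ifF; last by apply/eqP; lia.
rewrite subnS scalerMnl -mulr_natr factS natrM invfM mulrAC mulVf ?mul1r //.
by rewrite ch0.
Qed.

(** As D is multiplication by h + n on q^n, its powers are powers of h + n, and P(D) is P(h + n). *)
Lemma act_Ir (A : {poly {poly R}}) P r n m :
  act A (Ir (hcoef P) r) n m = Ir (hcoef (hact A P)) r n m.
Proof.
have itD l n' : iter l (@Dact R) (Ir (hcoef P) r) n' =1
    Ir (hcoef (fun i => ('X + i%:R) ^+ l * P i)) r n'.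
  elim: l n' => [|l IH] n' m' /=.
    by rewrite /Ir /hcoef expr0 mul1r.
  transitivity (Dact (Ir (hcoef (fun i => ('X + i%:R) ^+ l * P i)) r) n' m').
    by rewrite /Dact !IH.
  by rewrite Dact_Ir /Ir /hcoef exprS mulrA.
rewrite actE /Ir; case: (leqP m r) => hm; last first.
  apply: big1 => k _; apply: big1 => l _.
  by rewrite itD /Ir leqNgt hm mulr0.
rewrite /hcoef /hact coef_sum scaler_sumr; apply: eq_bigr => k _.
rewrite /actD comp_polyE mulr_suml coef_sum scaler_sumr; apply: eq_bigr => l _.
by rewrite itD /Ir hm /hcoef -scalerAl coefZ scalerAr.
Qed.

End PerturbedAction.

(** * Relations among two-point symbols and the recursion for Phi_j *)

Section TwoPointSymbols.
Variables (F : fieldType) (R : comAlgType F).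
Hypothesis charF : [pchar F] =i pred0.
Variables (v : seq (nat * nat) -> nat -> nat -> R) (a : nat -> nat -> R).
Hypothesis va : GW_valuation v a.
Hypothesis a00 : a 0 0 = 0.

(* The value at n = 0 stands for the symbol <H^j, tau_{-1} H_j> := 1, missing
   from the ring. *)
Definition Phi (j k n : nat) : R :=
  if n == 0%N then (j == k)%:R
  else if (j < n + k)%N then sv v [:: (0, j)%N] (n + k - j.+1) k else 0.

Lemma sv_neg l d k : (sdeg l d k < 0)%R -> sv v l d k = 0.
Proof. by rewrite /sv /inF => h; rewrite leNgt h. Qed.

Lemma sv_pos l d k : (0 <= sdeg l d k)%R -> sv v l d k = v l d k.
Proof. by rewrite /sv /inF => ->. Qed.

Lemma sdeg1 j d k : sdeg [:: (0, j)%N] d k = ((d + j).+1%:Z - k%:Z)%R.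
Proof. by rewrite /sdeg /=; lia. Qed.

Lemma sdegH1 j d k : sdeg [:: (0, 1)%N; (0, j)%N] d k = ((d + j).+1%:Z - k%:Z)%R.
Proof. by rewrite /sdeg /=; lia. Qed.

(** In degree 0, (GW2) would need d = n - 3 = -1 for a nonzero value. *)
Lemma sv1_deg0 j d k : ((d + j).+1 <= k)%N -> sv v [:: (0, j)%N] d k = 0.
Proof.
case: va => -[_ gw2 _ _ _] _ h.
have [e|ne] := eqVneq (d + j).+1 k.
  have s0 : sdeg [:: (0, j)%N] d k = 0 by rewrite sdeg1; lia.
  by rewrite sv_pos ?s0 // gw2.
by apply: sv_neg; rewrite sdeg1; lia.
Qed.

(** Move H^0 to the front; (GW3) then has no descendant index to lower. *)
Lemma H1H0H0 : v [:: (0, 1)%N; (0, 0)%N] 0 0 = 0.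
Proof.
case: va => -[gw1 _ gw3 _ _] _.
rewrite (gw1 _ [:: (0, 0)%N; (0, 1)%N]) //.
rewrite gw3 //; last by case=> i [[<-]].
by rewrite /= big_ord1 /= addr0.
Qed.

Lemma three_point j i : (i <= j)%N -> v [:: (0, 1)%N; (0, j)%N] 0 i = a i j.
Proof.
case: j => [|j] h; last by case: va => _; apply.
by move: h; rewrite leqn0 => /eqP ->; rewrite H1H0H0 a00.
Qed.

Lemma three_point_deg0 j : v [:: (0, 1)%N; (0, j)%N] 0 j.+1 = 1.
Proof.
case: va => -[_ gw2 _ _ _] _; rewrite gw2 /=; last by rewrite sdegH1; lia.
by rewrite !big_cons big_nil /= invr1 mul1r scale1r.
Qed.

(** The hypothesis is positivity of the degree in (GW4); H^j carries no descendant, so the middle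
    sum vanishes. *)
Lemma divisor_two_point j d k : (k <= d + j)%N ->
  v [:: (0, 1)%N; (0, j)%N] d k =
    ((d + j).+1 - k)%:R * sv v [:: (0, j)%N] d k +
    (if (0 < d)%N && (0 < k)%N then sv v [:: (0, j)%N] d.-1 k.-1 else 0).
Proof.
move=> h; case: va => -[_ _ _ gw4 _] _.
rewrite gw4 ?sdegH1; last by lia.
rewrite big_ord1 /= addr0; congr (_ * _ + _).
by rewrite subzn ?pmulrn //; lia.
Qed.

(** Second form of (GW5) with an empty family, hence a single splitting. *)
Lemma recursion_two_point j d k : (0 < d)%N -> (k <= d + j)%N ->
  v [:: (0, 1)%N; (0, j)%N] d k =
    \sum_(i < j.+1) a i j * sv v [:: (0, val i)%N] d.-1 k +
    sv v [:: (0, j.+1)%N] d.-1 k.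
Proof.
move=> hd h; case: va => -[_ _ _ _ gw5] _.
have hF : inF ([::] ++ [:: (0, 1); (0, j)]%N) d k.
  by rewrite /inF /= sdegH1; lia.
have [_ /(_ hd)] := gw5 [::] 0%N 1%N 0%N j d k hF.
rewrite /= => ->; rewrite (big_pred1 [tuple]) => [|m]; last first.
  by rewrite [m]tuple0 /= eqxx.
rewrite (_ : (0 + 0 + 1 + j + 0 + 0 + 2) = j.+3)%N; last by lia.
(* The index j+2 gives negative degree, j+1 the degree 0 symbol with value 1, and i <= j the
   generators. *)
rewrite 2!big_ord_recr /= [X in _ + X * _]sv_neg ?mul0r ?addr0; last first.
  by rewrite sdegH1; lia.
rewrite [X in _ + X * _]sv_pos ?three_point_deg0 ?mul1r; last by rewrite sdegH1; lia.
congr (_ + _); apply: eq_bigr => i _.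
have hi : (i <= j)%N by rewrite -ltnS.
by rewrite sv_pos ?three_point // sdegH1; lia.
Qed.

Lemma Phi_symbol j k n : (0 < n)%N -> (j < n + k)%N ->
  Phi j k n = sv v [:: (0, j)%N] (n + k - j.+1) k.
Proof. by move=> n0 h; rewrite /Phi eqn0Ngt n0 h. Qed.

Lemma Phi_small j k n : (n + k <= j)%N -> (0 < n)%N || (k < j)%N -> Phi j k n = 0.
Proof.
rewrite /Phi; case: (n == 0)%N / eqP => [-> _|_]; first by rewrite eq_sym => /ltn_eqF ->.
by rewrite leqNgt => /negbTE ->.
Qed.

Lemma Phi_recursion j k n :
  n%:R * Phi j k n + (if (0 < k)%N then Phi j k.-1 n else 0) =
    \sum_(i < j.+1) (if (j.+1 - i <= n)%N then a i j * Phi i k (n - (j.+1 - i)) else 0)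
    + Phi j.+1 k n.
Proof.
have [->|n0] := posnP n.
  rewrite mul0r add0r big1 ?add0r => [|i _].
    by case: k => [|k].
  by rewrite leqn0 subn_eq0 leqNgt ltn_ord.
have [hlt|hge] := ltnP (n + k) j.+1.
  rewrite big1 => [|i _].
    rewrite !Phi_small ?mulr0 ?addr0 ?n0 //; [|lia|lia].
    by rewrite if_same addr0.
  by case: ifP => // hi; rewrite Phi_small ?mulr0 //; lia.
have [d0|dp] := posnP (n + k - j.+1).
  have kj : (k < j.+1)%N by lia.
  have := divisor_two_point (kj : (k <= 0 + j)%N); rewrite add0n addr0 three_point // => e.
  rewrite (bigD1 (Ordinal kj)) //= big1 => [|i].
    rewrite (_ : n - (j.+1 - k) = 0)%N; last by lia.
    have -> : (j.+1 - k <= n)%N by lia.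
    rewrite /(Phi k) !eqxx mulr1 addr0 [Phi j.+1 _ _]Phi_small ?n0 //; last by lia.
    rewrite Phi_symbol // d0 addr0 e (_ : j.+1 - k = n)%N; last by lia.
    case: ifP => hk; last by rewrite addr0.
    by rewrite Phi_small ?addr0 ?n0 //; lia.
  rewrite -val_eqE /= => hik; case: ifP => // hi.
  by rewrite Phi_small ?mulr0 //; lia.
move: dp; move dE: (n + k - j.+1)%N => d dp.
have kd : (k <= d + j)%N by lia.
have := divisor_two_point kd; rewrite recursion_two_point // dp /=.
rewrite (_ : (d + j).+1 - k = n)%N; last by lia.
(* For d > 0 equate the divisor and recursion expansions of the same symbol. *)
move=> e; transitivity (\sum_(i < j.+1) a i j * sv v [:: (0, val i)%N] d.-1 k
  + sv v [:: (0, j.+1)%N] d.-1 k).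
  rewrite e Phi_symbol // dE; congr (_ + _); case: ifP => // hk.
  by rewrite Phi_symbol; [have -> : (n + k.-1 - j.+1 = d.-1)%N by lia | lia | lia].
congr (_ + _); last first.
  by rewrite Phi_symbol; [have -> : (n + k - j.+2 = d.-1)%N by lia | lia | lia].
apply: eq_bigr => i _; have hi := ltn_ord i.
case: ifP => h; last by rewrite sv1_deg0 ?mulr0 //=; lia.
have [e'|n'] := posnP (n - (j.+1 - i)).
  by rewrite e' sv1_deg0 /Phi /= ?ltn_eqF ?mulr0 //; lia.
by rewrite Phi_symbol; [have -> : (n - (j.+1 - i) + k - i.+1 = d.-1)%N by lia | lia | lia].
Qed.

(** The string relation (GW3) removes H^0 and lowers the last descendant index. *)
Lemma Phi0 k n : (0 < n)%N ->
  Phi 0 k n = if (2 <= n + k)%N then v [::] (n + k - 2) k else 0.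
Proof.
move=> n0; rewrite Phi_symbol //; last by lia.
case: va => -[_ _ gw3 _ _] _.
rewrite sv_pos ?sdeg1; last by lia.
rewrite gw3 ?big_ord0 ?add0r; [|rewrite /inF sdeg1; lia|by case=> i []].
rewrite subn1; case: ifP => h; last by rewrite ifF //; lia.
rewrite ifT; last by lia.
by rewrite sv_pos /sdeg /=; [congr (v _ _ _); lia|lia].
Qed.

Lemma natr_cancel (n : nat) (x : R) : (0 < n)%N -> n%:R * x = 0 -> x = 0.
Proof.
move=> n0; rewrite mulr_natl -scaler_nat => h; have ch0 := (pcharf0P F).1 charF.
have nF : (n%:R : F) != 0 by rewrite ch0; lia.
by rewrite -[x]scale1r -(mulVf nF) -scalerA h scaler0.
Qed.

(* For j > N topological recursion only keeps <H^(j+1), tau_(d-1) H_k>, so the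
   descendant index d goes down. *)
Lemma sv_beyond N j d k :
  (forall i j', (N < j')%N -> a i j' = 0) -> (N < j)%N -> (k <= N)%N ->
  sv v [:: (0, j)%N] d k = 0.
Proof.
move=> aN; elim: d j k => [|d IH] j k hj hk.
  apply: (@natr_cancel (j.+1 - k)); first by lia.
  have kj : (k <= j)%N by lia.
  have := divisor_two_point (kj : (k <= 0 + j)%N).
  by rewrite three_point // aN // addr0.
apply: (@natr_cancel ((d.+1 + j).+1 - k)); first by lia.
have kd : (k <= d.+1 + j)%N by lia.
have := divisor_two_point kd; rewrite recursion_two_point //=.
rewrite (IH j.+1) ?addr0; [|lia|lia].
rewrite big1 => [|i _]; last by rewrite aN ?mul0r.
have -> : (if (0 < k)%N then sv v [:: (0, j)%N] d k.-1 else 0) = 0.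
  by case: ifP => // _; apply: IH; lia.
by rewrite !addr0 => <-.
Qed.

Lemma Phi_beyond N k n :
  (forall i j, (N < j)%N -> a i j = 0) -> (k <= N)%N -> Phi N.+1 k n = 0.
Proof.
move=> aN hk; rewrite /Phi; case: eqP => _.
  by rewrite (_ : (N.+1 == k) = false) //; lia.
by case: ifP => // _; apply: sv_beyond aN _ hk.
Qed.

(** * Differential equations for the I-series and its regularization *)

Section Series.
Variable N : nat.
Hypothesis aN : forall i j, (N < j)%N -> a i j = 0.

Lemma coef_Ipoly k n : (k <= N)%N -> (Ipoly N v n)`_k = Phi 0 k n.
Proof.
move=> hk; rewrite /Ipoly coefD coef_sum.
have kN : (k < N.+1)%N by [].
have [->|n0] := posnP n.
  by rewrite big1 ?addr0 => [|i _]; rewrite ?coef0 // coef1 eq_sym.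
rewrite coef0 add0r.
rewrite (bigD1 (Ordinal kN)) //= big1 ?addr0 => [|i].
  rewrite Phi0 //; case: ifP => _; last by rewrite coef0.
  by rewrite coefZ coefXn eqxx mulr1.
rewrite -val_eqE /= => hik; case: ifP => _; last by rewrite coef0.
by rewrite coefZ coefXn eq_sym (negbTE hik) mulr0.
Qed.

Lemma hact_MQ i j (P : nat -> {poly R}) n : (i <= j)%N ->
  hact (MQ a i j) P n =
    (if i == j then ('X + n%:R) * P n else 0) -
    (if (j.+1 - i <= n)%N then (a i j)%:P * P (n - (j.+1 - i))%N else 0).
Proof.
rewrite leq_eqVlt /MQ; case/orP => [/eqP <-|hij].
  rewrite eqxx subSnn hactD hactN hactC comp_polyX; congr (_ - _).
  by have := hact_monom (a i i)%:P 1 P n; rewrite comp_polyC.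
rewrite hij (ltn_eqF hij).
by rewrite hactN hact_monom comp_polyC sub0r addn1 -subSn // ltnW.
Qed.

(** Strong induction on j: the Hessenberg recursion is [Phi_recursion] solved for Phi_{j+1}. *)
Lemma coef_hact_detlead j k n : (k <= N)%N ->
  (hact (detlead (MQ a) j) (Ipoly N v) n)`_k = Phi j k n.
Proof.
elim/ltn_ind: j k n => -[|j] IH k n hk; first by rewrite hact1 coef_Ipoly.
rewrite hact_detlead_Hessenberg; first last.
- by move=> p q h; rewrite /MQ !ifF //; lia.
- by move=> p; rewrite /MQ eqxx !ifF //; lia.
rewrite coef_sum.
pose g i := if (j.+1 - i <= n)%N then a i j * Phi i k (n - (j.+1 - i)) else 0.
transitivity (\sum_(i < j.+1) ((if i == ord_max then
   n%:R * Phi j k n + (if (0 < k)%N then Phi j k.-1 n else 0) else 0) - g i)).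
  apply: eq_bigr => i _; have hi : (i <= j)%N by rewrite -ltnS.
  rewrite hact_MQ // coefB -val_eqE /=; congr (_ - _).
    case: eqP => [->|_]; last by rewrite coef0.
    rewrite mulrDl coefD coefXM mulr_natl coefMn !IH ?(leq_trans (leq_pred k)) //.
    by rewrite mulr_natl addrC; case: (k).
  by rewrite /g; case: ifP => _; rewrite ?coef0 // coefCM IH.
rewrite sumrB -big_mkcond /= big_pred1_eq Phi_recursion addrC addrA addNr.
by rewrite add0r.
Qed.

Lemma LQ_annihilates k n : (k <= N)%N ->
  (hact (LQ N a) (Ipoly N v) n)`_k = 0.
Proof. by move=> hk; rewrite (coef_hact_detlead N.+1) // Phi_beyond. Qed.

Lemma Itpoly_Ipoly n :
  Itpoly N v n = \prod_(l < n) ('X + (l.+1)%:R) * Ipoly N v n.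
Proof.
rewrite /Itpoly /Ipoly mulrDr mulr_sumr; congr (_ + _).
  by case: n => [|n]; rewrite ?big_ord0 ?mul1r // mulr0.
apply: eq_bigr => j _; case: ifP => _; last by rewrite mulr0.
by rewrite -scalerAr mulrC.
Qed.

Lemma regularized_annihilates L k n : LN_spec (LQ N a) L -> (k < N)%N ->
  (hact L (Itpoly N v) n)`_k = 0.
Proof.
move=> hL hk.
(* D multiplies the q^n coefficient by h + n, so D L can be replaced by its definition. *)
have key i : (i <= N)%N -> (('X + n%:R) * hact L (Itpoly N v) n)`_i = 0.
  move=> hi; rewrite -[X in X * _]comp_polyX -hactC -/(Dop R) -hact_opmul hL.
  rewrite (eq_hact _ _ Itpoly_Ipoly) regularized_hact coefM big1 // => j _.
  by rewrite LQ_annihilates ?mulr0 //; lia.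
(* For n = 0 the factor is h, which shifts coefficients by one; hence the bound k < N. *)
have [n0|n0] := posnP n.
  by have := key k.+1 hk; rewrite n0 addr0 coefXM.
(* For n > 0 the system is triangular in k with n on the diagonal. *)
elim: k hk => [|k IH] hk; apply: (natr_cancel n0).
  have := key 0%N (leq0n _).
  by rewrite mulrDl coefD coefXM add0r mulr_natl coefMn mulr_natl.
have := key k.+1 (ltnW hk).
by rewrite mulrDl coefD coefXM IH ?(ltnW hk) // add0r mulr_natl coefMn mulr_natl.
Qed.

End Series.
End TwoPointSymbols.

(** * Specialization to K *)

Lemma pchar_CC : [pchar CC] =i pred0.
Proof. exact: Num.Theory.pchar_num. Qed.

Theorem theorem3p3 (N : nat) (hN : (1 <= N)%N)
    (v : seq (nat * nat) -> nat -> nat -> K N) :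
  GW_valuation v (aK N) ->
  perturbed_solution N (Icoef N v) (LQ N (aK N)) /\
  (forall L : {poly {poly K N}},
     LN_spec (LQ N (aK N)) L ->
     perturbed_solution N.-1 (Itcoef N v) L).
Proof.
move=> gw.
have a00 : aK N 0 0 = 0 by [].
have aN i j : (N < j)%N -> aK N i j = 0.
  by move=> h; rewrite /aK (leqNgt j) h !andbF.
split=> [|L hL] r hr n m.
  (* I_r involves only powers of h up to r, so the truncation modulo h^(N+1) is invisible. *)
  rewrite (@eq_act _ _ _ _ (Ir (hcoef (Ipoly N v)) r)) => [|n' m'].
    rewrite (act_Ir pchar_CC) /Ir; case: ifP => // _.
    by rewrite /hcoef (LQ_annihilates pchar_CC gw a00 aN) ?scaler0 //; lia.
  by rewrite /Ir /Icoef; case: ifP => // _; rewrite ifT //; lia.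
rewrite (@eq_act _ _ _ _ (Ir (hcoef (Itpoly N v)) r)) => [|n' m'].
  rewrite (act_Ir pchar_CC) /Ir; case: ifP => // _.
  by rewrite /hcoef (regularized_annihilates pchar_CC gw a00 aN _ hL) ?scaler0 //; lia.
by rewrite /Ir /Itcoef; case: ifP => // _; rewrite ifT //; lia.
Qed.
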